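(* In the team-design model described in the context, fix an orthonormal basis $(\phi_i)_{i=1}^\infty$ and let $\Lambda:[0,\varepsilon]\to\ell^1_+$ be continuously differentiable as a map into $\ell^1$, where $\Lambda(t)=(\lambda_1(t),\lambda_2(t),\dots)$ is nonzero and weakly decreasing in $i$ for every $t$. Suppose further that $C_t(x,x'):=\sum_{i=1}^\infty\lambda_i(t)\phi_i(x)\phi_i(x')$ is a continuous covariance kernel satisfying the feasibility assumptions of the model for every $t\in[0,\varepsilon]$. Assume further that there is a uniquely optimal interior team size at all $t\in[0,\varepsilon]$. Let $n$ denote the number of modes in headquarters' attention problem at $t=0$ and define $\frac1{4k}\mu^*(0)$ as the water level at $t=0$ when team size is $k$. Team size is weakly increasing in $t$ at $t=0$ if and only if $$\sum_{i=1}^\infty\lambda_i'(0)\left(\min\Big\{1,\frac{\mu^*(0)}{\lambda_i(0)}\Big\}-\frac{n\mu^*(0)+\sum_{m=n+1}^\infty\lambda_m(0)}{\sum_{m=1}^\infty\lambda_m(0)}\right)\ge0,$$ and weakly decreasing if the reverse inequality holds.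
   Context: Model. For a mean-zero Gaussian process $W_0$ on $[0,1]$ with symmetric, continuous, positive definite covariance kernel $C$ with finite integrated variance (these are the feasibility assumptions), let $\lambda_1\ge\lambda_2\ge\dots$ be the eigenvalues of the covariance operator; it is assumed throughout that infinitely many are strictly positive. The function $f:[1,\infty)\to\mathbb R$ is strictly increasing and smooth, with $f(1)=1$ and $\lim_{k\to\infty}f(k)=\infty$. Given attention capacity $\rho>0$, $\mu^*>0$ is the unique number with $\frac12\sum_i\max\{0,\log(\lambda_i/\mu^* )\}=\rho$, and $n=\#\{i:\lambda_i>\mu^*\}$ is the number of modes in headquarters' attention problem (both independent of $k$); for team size $k$ the water level is $\mu=\mu^*/(4k)$. Under the optimal signal of mutual information at most $\rho$ about the team-state process $W_1(u)=W_0(ku)/2$ on $[0,1/k]$, the organization's total (coordination plus adaptation) loss from team size $k\in[1,\infty)$ is $$L(k)=\frac1{4k}\Big(n\mu^*+\sum_{i=n+1}^\infty\lambda_i\Big)+\frac{f(k)}2\sum_{i=1}^\infty\lambda_i .$$ An optimal team size minimizes $L$ over $[1,\infty)$; it is interior if it is $>1$. For the path $C_t$, the eigenvalues are $\lambda_i(t)$, $\mu^*(t)$ denotes the corresponding value of $\mu^*$, and ''team size'' at $t$ means the optimal team size for $C_t$; $\rho$ and $f$ are held fixed.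
   Formalization: Added: if the displayed sum is exactly 0, the loss at t=0 has strictly positive second derivative at the optimal team size (else the claim can fail); ''weakly increasing/decreasing at t=0'' is read to first order, via the right Dini derivatives of team size. *)

(* Defs.v *)
From HB Require Import structures.
From mathcomp Require Import all_boot all_order all_algebra finmap.
From mathcomp Require Import all_classical all_reals all_analysis.
Import Order.TTheory GRing.Theory Num.Theory.
Import numFieldNormedType.Exports.

Set Implicit Arguments.
Unset Strict Implicit.
Unset Printing Implicit Defensive.

Local Open Scope classical_set_scope.
Local Open Scope ring_scope.

(* Modes are numbered from 0: [lam i] is the (i+1)-st eigenvalue, so the tail
   "sum over i >= n+1" is [\sum_(n <= i <oo) lam i]. *)
Notation "\sum_ ( m <= i '<oo' ) F" :=
  (\big[+%R/0%R]_(m <= i <oo) F%R) : ring_scope.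

Definition I01 (R : realType) : set R := `[0, 1].
Arguments I01 : clear implicits.

Definition square_integrable (R : realType) (g : R -> R) : Prop :=
  measurable_fun (I01 R) g /\
  (\int[lebesgue_measure]_(x in I01 R) (g x ^+ 2)%:E < +oo)%E.

Definition L2_inner (R : realType) (g h : R -> R) : R :=
  \int[lebesgue_measure]_(x in I01 R) (g x * h x).

Definition orthonormal_basis (R : realType) (phi : nat -> R -> R) : Prop :=
  [/\ forall i, square_integrable (phi i),
      forall i j, L2_inner (phi i) (phi j) = (i == j)%:R
    & forall g, square_integrable g ->
        (\int[lebesgue_measure]_(x in I01 R)
           ((g x - \sum_(i < N) L2_inner g (phi i) * phi i x) ^+ 2)%:E)%E
          @[N --> \oo] --> 0%E].

Definition spectral_kernel (R : realType) (phi : nat -> R -> R)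
    (lam : nat -> R) (x y : R) : R :=
  \sum_(0 <= i <oo) (lam i * phi i x * phi i y).

(* The convergence clause is what makes [spectral_kernel] meaningful: the limit
   operator is total. *)
Definition kernel_converges (R : realType) (phi : nat -> R -> R)
    (lam : nat -> R) : Prop :=
  forall x y : R, I01 R x -> I01 R y ->
    cvgn (series (fun i => lam i * phi i x * phi i y)).

(* "Positive definite" in the sense of kernel theory, i.e. every Gram matrix is
   positive semidefinite: covariance kernels of Gaussian processes. *)
Definition feasible_kernel (R : realType) (C : R -> R -> R) : Prop :=
  [/\ forall x y : R, I01 R x -> I01 R y -> C x y = C y x,
      {within (I01 R `*` I01 R), continuous (fun p : R * R => C p.1 p.2)},
      forall (N : nat) (x c : 'I_N -> R), (forall i, I01 R (x i)) ->
        0 <= \sum_(i < N) \sum_(j < N) c i * c j * C (x i) (x j)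
    & (\int[lebesgue_measure]_(x in I01 R) (C x x)%:E < +oo)%E].

Definition l1norm (R : realType) (u : nat -> R) : \bar R :=
  (\sum_(i <oo) `|u i|%:E)%E.

(* A nonzero, weakly decreasing element of the positive cone of l^1, with
   infinitely many strictly positive entries. *)
Definition spectrum (R : realType) (lam : nat -> R) : Prop :=
  [/\ forall i, 0 <= lam i,
      (l1norm lam < +oo)%E,
      exists i, lam i != 0,
      {homo lam : i j / (i <= j)%N >-> j <= i}
    & forall N, exists2 i, (N <= i)%N & 0 < lam i].

(* [lam] is continuously differentiable from [0, eps] into l^1, with derivative
   [dlam]; derivatives at the endpoints are one-sided. *)
Definition C1_into_l1 (R : realType) (eps : R) (lam dlam : R -> nat -> R) :
    Prop :=
  forall t, t \in `[0, eps] ->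
    [/\ (l1norm (dlam t) < +oo)%E,
        l1norm (fun i => (lam s i - lam t i) / (s - t) - dlam t i)
          @[s --> within `[0, eps] t^'] --> 0%E
      & l1norm (fun i => dlam s i - dlam t i)
          @[s --> within `[0, eps] (nbhs t)] --> 0%E].

(* Smoothness on the non-open set [1, +oo[ means smooth extendability; values
   of [f] below 1 are irrelevant. *)
Definition coordination_cost (R : realType) (f : R -> R) : Prop :=
  [/\ {in `[1, +oo[ &, {homo f : x y / x < y}},
      exists F : R -> R, (forall (m : nat) (x : R), derivable (derive1n m F) x 1)
                         /\ {in `[1, +oo[, F =1 f},
      f 1 = 1
    & f x @[x --> +oo] --> +oo].

(* The water level at team size [k] is [mu / (4 * k)]. *)
Definition is_mustar (R : realType) (rho : R) (lam : nat -> R) (mu : R) : Prop :=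
  0 < mu /\
  2^-1 * \sum_(0 <= i <oo) Num.max 0 (ln (lam i / mu)) = rho.

(* The set is finite as soon as [lam] is summable and [0 < mu]. *)
Definition attention_modes (R : realType) (mu : R) (lam : nat -> R) : nat :=
  (#|` fset_set [set i : nat | mu < lam i]%classic|)%fset.

Definition residual_variance (R : realType) (mu : R) (lam : nat -> R) : R :=
  let n := attention_modes mu lam in n%:R * mu + \sum_(n <= i <oo) lam i.

Definition team_loss (R : realType) (f : R -> R) (mu : R) (lam : nat -> R)
    (k : R) : R :=
  (4 * k)^-1 * residual_variance mu lam
  + f k / 2 * \sum_(0 <= i <oo) lam i.

Definition uniquely_optimal (R : realType) (L : R -> R) (k : R) : Prop :=
  1 <= k /\ forall k', 1 <= k' -> k' != k -> L k < L k'.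

(* First-order monotonicity to the right of 0: the lower (resp. upper) right
   Dini derivative of [k] at 0 is >= 0 (resp. <= 0). If [k] has a right
   derivative at 0, possibly infinite, this is a condition on its sign. *)
Definition weakly_increasing_at0 (R : realType) (k : R -> R) : Prop :=
  forall e : R, 0 < e -> \forall t \near 0^'+, - e <= (k t - k 0) / t.

Definition weakly_decreasing_at0 (R : realType) (k : R -> R) : Prop :=
  forall e : R, 0 < e -> \forall t \near 0^'+, (k t - k 0) / t <= e.

Definition team_size_criterion (R : realType) (mu : R) (lam dlam : nat -> R) : R :=
  \sum_(0 <= i <oo)
    (dlam i * (Num.min 1 (mu / lam i)
               - residual_variance mu lam / \sum_(0 <= m <oo) lam m)).

(* Main.v *)
(** Write [A] for the residual variance, [B] for the total variance, and
    [w i = min 1 (mu / lam i)]. The function [min l m + m * ln^+ (l / m)] is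
    jointly concave and homogeneous of degree one, with gradient
    [(min 1 (m / l), ln^+ (l / m))]. Summing its tangent inequality over the
    modes, the capacity constraint eliminates the [ln^+] terms and leaves
    [A t <= \sum_i w_0 i * lam_t i] and [A 0 <= \sum_i w_t i * lam_0 i]. Since
    the water level is continuous, these two bounds squeeze the right
    derivative of [A] at 0 to [\sum_i w_0 i * lam'_0 i], so
    [q t = A t * B 0 - A 0 * B t] satisfies [q t / t --> B 0 * criterion].
    Revealed preference makes [k t - k 0] have the sign of [q t], and the
    first-order condition turns [q t] into the slope of the loss of time 0 at
    [k t]. As [k t --> k 0], the second derivative of that loss at [k 0] then
    gives a strict decrease of first order when the criterion is negative, and
    a vanishing derivative of [k] when it is zero and the second derivative is
    positive. *)
Require Import Defs.
From HB Require Import structures.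
From mathcomp Require Import all_boot all_order all_algebra.
From mathcomp Require Import all_classical all_reals all_analysis.
From mathcomp Require Import ring lra.
Import Order.TTheory GRing.Theory Num.Theory.
Import numFieldNormedType.Exports.

Set Implicit Arguments.
Unset Strict Implicit.
Unset Printing Implicit Defensive.

Local Open Scope classical_set_scope.
Local Open Scope ring_scope.

(** * Absolutely summable sequences and their sums *)

Section l1.
Variable R : realType.
Implicit Types (u v w : nat -> R) (c : R).

Local Notation in_l1 u := (l1norm u%R < +oo)%E.

Lemma l1norm_ge0 u : (0 <= l1norm u)%E.
Proof. by apply: nneseries_ge0 => i _ _; rewrite lee_fin. Qed.

Lemma l1norm_le u v : (forall i, `|u i| <= `|v i|) -> (l1norm u <= l1norm v)%E.
Proof.
by move=> uv; apply: lee_nneseries => i *; rewrite lee_fin.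
Qed.

Lemma in_l1_le u v : in_l1 v -> (forall i, `|u i| <= `|v i|) -> in_l1 u.
Proof. by move=> vfin /l1norm_le/le_lt_trans; exact. Qed.

Lemma in_l1D u v : in_l1 u -> in_l1 v -> in_l1 (fun i => u i + v i).
Proof.
move=> ufin vfin.
apply: (@le_lt_trans _ _ (l1norm u + l1norm v)%E); last by rewrite lte_add_pinfty.
rewrite /l1norm -nneseriesD//.
by apply: lee_nneseries => i *; rewrite -?EFinD lee_fin// ler_normD.
Qed.

Lemma in_l1Z c u : in_l1 u -> in_l1 (fun i => c * u i).
Proof.
move=> ufin; rewrite /l1norm.
under eq_eseriesr => i _ do rewrite normrM EFinM.
rewrite nneseriesZl; last by move=> i _; rewrite lee_fin.
by rewrite lte_mul_pinfty// lee_fin.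
Qed.

Lemma in_l1B u v : in_l1 u -> in_l1 v -> in_l1 (fun i => u i - v i).
Proof.
move=> ufin vfin; apply: in_l1D => //.
by apply: in_l1_le vfin _ => i; rewrite normrN.
Qed.

Lemma in_l1_normed_cvg u : in_l1 u -> cvgn [normed series u].
Proof. exact: (@nnseries_is_cvg _ (fun i => `|u i|)). Qed.

Lemma in_l1_cvg u : in_l1 u -> cvgn (series u).
Proof. by move=> /in_l1_normed_cvg/normed_cvg. Qed.

Lemma l1_sumD u v : in_l1 u -> in_l1 v ->
  \sum_(0 <= i <oo) (u i + v i) = \sum_(0 <= i <oo) u i + \sum_(0 <= i <oo) v i.
Proof. by move=> /in_l1_cvg cu /in_l1_cvg cv; rewrite -(lim_seriesD cu cv). Qed.

Lemma l1_sumB u v : in_l1 u -> in_l1 v ->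
  \sum_(0 <= i <oo) (u i - v i) = \sum_(0 <= i <oo) u i - \sum_(0 <= i <oo) v i.
Proof. by move=> /in_l1_cvg cu /in_l1_cvg cv; rewrite -(lim_seriesB cu cv). Qed.

Lemma l1_sumZ c u : in_l1 u ->
  \sum_(0 <= i <oo) (c * u i) = c * \sum_(0 <= i <oo) u i.
Proof. by move=> /in_l1_cvg cu; rewrite -[RHS](lim_seriesZ _ cu). Qed.

Lemma le_l1_sum u v : in_l1 u -> in_l1 v -> (forall i, u i <= v i) ->
  \sum_(0 <= i <oo) u i <= \sum_(0 <= i <oo) v i.
Proof. by move=> /in_l1_cvg cu /in_l1_cvg cv uv; exact: lim_series_le. Qed.

Lemma eq_sum_oo u v : u =1 v ->
  \sum_(0 <= i <oo) u i = \sum_(0 <= i <oo) v i.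
Proof. by move=> /funext ->. Qed.

Lemma sum_oo_ge_term u i : in_l1 u -> (forall j, 0 <= u j) ->
  u i <= \sum_(0 <= j <oo) u j.
Proof.
move=> /in_l1_cvg cu u0.
apply: le_trans (nondecreasing_cvgn_le _ cu i.+1).
  by rewrite seriesSr lerDr /series /= sumr_ge0.
by apply: nondecreasing_series => j _ _; exact: u0.
Qed.

Lemma l1_sum_norm_le u c : (l1norm u <= c%:E)%E -> `|\sum_(0 <= i <oo) u i| <= c.
Proof.
move=> uc; have ufin : in_l1 u by rewrite (le_lt_trans uc) ?ltry.
have nc := in_l1_normed_cvg ufin.
apply: le_trans (lim_series_norm nc) _.
apply: limr_le => //; apply: nearW => n.
rewrite -lee_fin; apply: le_trans uc.
rewrite -sumEFin; apply: nneseries_lim_ge => i *; exact: normr_ge0.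
Qed.

Lemma in_l1_fin u : in_l1 u -> exists c, l1norm u = c%:E.
Proof.
move=> ufin; exists (fine (l1norm u)); rewrite fineK// ge0_fin_numE//.
exact: l1norm_ge0.
Qed.

(** Dominated convergence for series: as the weights are bounded by 1, the tail of [v] makes a
    uniformly small contribution, and the finite head converges term by term. *)
Lemma weighted_sum_cvg (T : Type) (F : set_system T) {FF : Filter F}
    (w : T -> nat -> R) (w0 v : nat -> R) :
    in_l1 v ->
    (\forall t \near F, forall i, `|w t i| <= 1) -> (forall i, `|w0 i| <= 1) ->
    (forall i, w t i @[t --> F] --> w0 i) ->
  \sum_(0 <= i <oo) (w t i * v i) @[t --> F] --> \sum_(0 <= i <oo) (w0 i * v i).
Proof.
move=> vfin w1 w01 wcvg.
have wl1 x : (forall i, `|x i| <= 1) -> in_l1 (fun i => x i * v i).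
  move=> x1; apply: in_l1_le vfin _ => i.
  by rewrite normrM ler_piMl.
apply/cvgrPdist_le => /= e e0.
(* The head takes [e / 4]; the tail takes twice [e / 4], since two weights differ by at most 2. *)
have e4 : 0 < e / 4 by rewrite divr_gt0.
have : (\sum_(N <= k <oo) (`|v k|)%:E @[N --> \oo] --> 0)%E.
  by apply: nneseries_tail_cvg => // k _; rewrite lee_fin.
move=> /fine_cvgP[_] /cvgrPdist_lt /(_ _ e4) [N _ /(_ N (leqnn N))]/=.
rewrite sub0r normrN => tailN.
have tail0 : (0 <= \sum_(N <= k <oo) (`|v k|)%:E)%E.
  by apply: nneseries_ge0 => k _ _; rewrite lee_fin.
have tailfin : (\sum_(N <= k <oo) (`|v k|)%:E < +oo)%E.
  apply: le_lt_trans vfin; rewrite /l1norm.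
  rewrite [leRHS](nneseries_split _ N); last by move=> k _; rewrite lee_fin.
  by rewrite add0n leeDr// sume_ge0// => i _; rewrite lee_fin.
have head : \forall t \near F,
    \sum_(0 <= k < N) `|(w0 k - w t k) * v k| < e / 4.
  have : \sum_(0 <= k < N) `|(w0 k - w t k) * v k| @[t --> F]
           --> \sum_(0 <= k < N) `|(w0 k - w0 k) * v k|.
    apply: cvg_big => [|k _]; first exact: add_continuous.
    apply: cvg_norm; apply: cvgMr_tmp.
    by apply: cvgB; [exact: cvg_cst|exact: wcvg].
  rewrite [X in _ --> X]big1; last by move=> k _; rewrite subrr mul0r normr0.
  move=> /cvgrPdist_lt /(_ _ e4); apply: filterS => t.
  by rewrite sub0r normrN ger0_norm// sumr_ge0.
apply: filterS2 w1 head => t w1 head.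
rewrite -l1_sumB; [|exact: wl1..].
apply: l1_sum_norm_le.
rewrite /l1norm (nneseries_split _ N); last by move=> k _; rewrite lee_fin.
rewrite add0n.
apply: (@le_trans _ _ ((e / 4)%:E + 2%:E * (\sum_(N <= k <oo) (`|v k|)%:E)))%E.
  apply: leeD.
    rewrite sumEFin lee_fin.
    by under eq_bigr => k _ do rewrite -mulrBl; exact: ltW.
  rewrite -nneseriesZl; last by move=> k _; rewrite lee_fin.
  apply: lee_nneseries => k *; first by rewrite lee_fin.
  rewrite -EFinM lee_fin -mulrBl normrM ler_wpM2r//.
  by apply: le_trans (ler_normB _ _) _; rewrite -[2]/(1 + 1) lerD.
rewrite -(@fineK _ (\sum_(N <= k <oo) _)%E); last by rewrite ge0_fin_numE.
rewrite -EFinM -EFinD lee_fin.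
have := ler_norm (fine (\sum_(N <= k <oo) (`|v k|)%:E)).
by move: tailN; lra.
Qed.

End l1.

(** * Limits of sums along families converging in the l1 norm *)

Section cvg_l1.
Context {R : realType} {T : Type} {F : set_system T} {FF : ProperFilter F}.
Variables (v : T -> nat -> R) (v0 : nat -> R).
Hypothesis v0_fin : (l1norm v0 < +oo)%E.
Hypothesis v_cvg : l1norm (fun i => v t i - v0 i) @[t --> F] --> 0%E.

Lemma near_l1norm_le (e : R) : 0 < e ->
  \forall t \near F, (l1norm (fun i => v t i - v0 i)%R <= e%:E)%E.
Proof.
move=> e0; have /fine_cvgP[vfin /cvgrPdist_le /(_ _ e0)] := v_cvg.
apply: filterS2 vfin => t vfin; rewrite sub0r normrN => le_e.
by rewrite -(fineK vfin) lee_fin (le_trans (ler_norm _)).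
Qed.

Lemma near_in_l1 : \forall t \near F, (l1norm (v t) < +oo)%E.
Proof.
have := near_l1norm_le ltr01; apply: filterS => t vt.
have -> : v t = fun i => (v t i - v0 i) + v0 i.
  by apply/funext => i; rewrite subrK.
by apply: in_l1D => //; rewrite (le_lt_trans vt) ?ltry.
Qed.

Lemma l1_cvg_entry i : v t i @[t --> F] --> v0 i.
Proof.
apply/cvgrPdist_le => /= e /near_l1norm_le; apply: filterS => t vt.
rewrite distrC -lee_fin; apply: le_trans vt.
apply: le_trans (nneseries_lim_ge i.+1 _) => /=; last by move=> k *; rewrite lee_fin.
by rewrite big_nat_recr//= leeDr// sume_ge0// => k _; rewrite lee_fin.
Qed.

(** Splits [w t * v t - w0 * v0] into [w t * (v t - v0)], bounded by the l1 distance, and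
    [(w t - w0) * v0], covered by dominated convergence. *)
Lemma l1_weighted_sum_cvg (w : T -> nat -> R) (w0 : nat -> R) :
    (\forall t \near F, forall i, `|w t i| <= 1) -> (forall i, `|w0 i| <= 1) ->
    (forall i, w t i @[t --> F] --> w0 i) ->
  \sum_(0 <= i <oo) (w t i * v t i) @[t --> F] --> \sum_(0 <= i <oo) (w0 i * v0 i).
Proof.
move=> w1 w01 wcvg.
apply/cvgrPdist_le => /= e e0; have e2 : 0 < e / 2 by rewrite divr_gt0.
have /(_ _)/cvgrPdist_le /(_ _ e2) := weighted_sum_cvg v0_fin w1 w01 wcvg.
move=> wt; apply: filterS3 (filterI w1 wt) near_in_l1 (near_l1norm_le e2).
move=> t [{}w1 {}wt] vfin vt.
have wl1 (u : nat -> R) : (l1norm u < +oo)%E -> (l1norm (fun i => w t i * u i)%R < +oo)%E.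
  by move=> ufin; apply: in_l1_le ufin _ => i; rewrite normrM ler_piMl.
rewrite (splitr e) -(subrKA (\sum_(0 <= i <oo) (w t i * v0 i))).
apply: le_trans (ler_normD _ _) (lerD wt _).
rewrite distrC -l1_sumB; [|exact: wl1..].
apply: l1_sum_norm_le; apply: le_trans vt; apply: l1norm_le => i.
by rewrite -mulrBr normrM ler_piMl.
Qed.

Lemma l1_sum_cvg :
  \sum_(0 <= i <oo) v t i @[t --> F] --> \sum_(0 <= i <oo) v0 i.
Proof.
have one u : \sum_(0 <= i <oo) u i = \sum_(0 <= i <oo) (1 * u i) :> R.
  by apply: eq_sum_oo => i; rewrite mul1r.
rewrite one; under eq_cvg do rewrite one.
apply: (@l1_weighted_sum_cvg (fun _ _ => 1) (fun=> 1)) => [|i|i].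
- by apply: nearW => t i; rewrite normr1.
- by rewrite normr1.
- exact: cvg_cst.
Qed.

End cvg_l1.

(** * Water-filling on a single mode *)

Section waterfilling.
Variable R : realType.
Implicit Types (l m rho : R) (lam : nat -> R).

(** Twice the capacity spent on a mode of variance [l] at water level [m]. *)
Definition excess (m l : R) : R := Num.max 0 (ln (l / m)).
(** The share of the variance [l] of a mode that attention leaves unresolved at water level [m]. *)
Definition passthrough (m l : R) : R := Num.min 1 (m / l).

Lemma ln_leB1 (x : R) : 0 < x -> ln x <= x - 1.
Proof.
by move=> x0; have := @le_ln1Dx R (x - 1); rewrite [1 + _]addrC subrK; apply; lra.
Qed.

Lemma excess_ge0 m l : 0 <= excess m l.
Proof. by rewrite /excess le_max lexx. Qed.

Lemma passthroughM m l : 0 < l -> passthrough m l * l = Num.min l m.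
Proof.
move=> l0; rewrite /passthrough minr_pMl; last exact: ltW.
by rewrite mul1r divfK// gt_eqF.
Qed.

Lemma passthrough_norm_le1 m l : 0 < m -> 0 < l -> `|passthrough m l| <= 1.
Proof.
move=> m0 l0; rewrite ger0_norm /passthrough ?ge_min ?lexx//.
by rewrite le_min ler01 ltW// divr_gt0.
Qed.

(* [min l m + m * excess m l] is jointly concave and homogeneous of degree 1 in
   [(l, m)], with gradient [(passthrough m l, excess m l)]; by Euler's identity
   its tangent plane at [(l, m)] is the right-hand side. *)
Lemma waterfilling_tangent l m l' m' : 0 < l -> 0 < m -> 0 < l' -> 0 < m' ->
  Num.min l' m' + m' * excess m' l' <= passthrough m l * l' + m' * excess m l.
Proof.
move=> l0 m0 l'0 m'0; rewrite /excess /passthrough.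
set x := l' / m'; have x0 : 0 < x by rewrite divr_gt0.
have l'E : l' = x * m' by rewrite /x divfK// gt_eqF.
(* The base point [(l, m)] enters only through [w = min 1 (m / l)], because its excess is
   [- ln w]. *)
have [w [w0 w1 -> ->]] : exists w, [/\ 0 < w, w <= 1,
    Num.min 1 (m / l) = w & Num.max 0 (ln (l / m)) = - ln w].
  have [lm|ml] := leP l m.
    exists 1; split=> //.
    - by apply/min_idPl; rewrite ler_pdivlMr// mul1r.
    - by rewrite ln1 oppr0; apply/max_idPl/ln_le0; rewrite ler_pdivrMr// mul1r.
  have ml1 : m / l < 1 by rewrite ltr_pdivrMr// mul1r.
  exists (m / l); split; [by rewrite divr_gt0|exact: ltW|exact/min_idPr/ltW|].
  rewrite -lnV ?posrE ?divr_gt0// invf_div; apply/max_idPr/ln_ge0.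
  by rewrite ler_pdivlMr// mul1r ltW.
have minE : Num.min l' m' = m' * Num.min x 1.
  by rewrite minr_pMr ?mulr1; [rewrite mulrC -l'E|exact: ltW].
have -> : w * l' + m' * - ln w = m' * (w * x - ln w) by rewrite l'E; ring.
rewrite minE -mulrDr ler_pM2l//.
(* After division by [m'] the claim is [min x 1 + ln^+ x <= w * x - ln w]. Both cases rest on
   [ln y <= y - 1]: at [y = w], combined with [(1 - w) * (1 - x) >= 0], if [x <= 1], and at
   [y = w * x] otherwise. *)
have [x1|x1] := leP x 1.
  have -> : Num.max 0 (ln x) = 0 by apply/max_idPl/ln_le0.
  have : (1 - w) * (1 - x) >= 0 by rewrite mulr_ge0// subr_ge0.
  by have := ln_leB1 w0; lra.
have -> : Num.max 0 (ln x) = ln x by apply/max_idPr/ln_ge0/ltW.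
by have := ln_leB1 (mulr_gt0 w0 x0); rewrite lnM ?posrE//; lra.
Qed.

Lemma excess_le m l : 0 < m -> 0 < l -> `|excess m l| <= `|m^-1 * l|.
Proof.
move=> m0 l0; have x0 : 0 < l / m by rewrite divr_gt0.
rewrite ger0_norm ?excess_ge0// mulrC gtr0_norm//.
by rewrite /excess ge_max !ltW// ln_sublinear.
Qed.

(** The function [ln^+] is 1-Lipschitz on the positive axis, since the slope [1 / x] counts only
    where [x >= 1]. Summed over modes, this makes the capacity used at a fixed level continuous in
    the l1 norm. *)
Lemma excess_lipschitz m l l' : 0 < m -> 0 < l -> 0 < l' ->
  `|excess m l' - excess m l| <= `|m^-1 * (l' - l)|.
Proof.
have main (x y : R) : 0 < x -> x <= y ->
    `|Num.max 0 (ln y) - Num.max 0 (ln x)| <= `|y - x|.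
  move=> x0 xy; have y0 := lt_le_trans x0 xy.
  have lnxy : ln x <= ln y by rewrite ler_ln.
  rewrite [leRHS]ger0_norm ?subr_ge0//.
  rewrite ger0_norm; last by rewrite subr_ge0 ge_max le_max lexx/= le_max lnxy orbT.
  have [y1|y1] := leP y 1.
    have -> : Num.max 0 (ln y) = 0 by apply/max_idPl/ln_le0.
    have : 0 <= Num.max 0 (ln x) by rewrite le_max lexx.
    by move: xy; lra.
  have -> : Num.max 0 (ln y) = ln y by apply/max_idPr/ln_ge0/ltW.
  have [x1|x1] := leP x 1.
    have -> : Num.max 0 (ln x) = 0 by apply/max_idPl/ln_le0.
    by have := ln_leB1 y0; lra.
  have -> : Num.max 0 (ln x) = ln x by apply/max_idPr/ln_ge0/ltW.
  rewrite -ln_div ?posrE//; apply: le_trans (ln_leB1 (divr_gt0 y0 x0)) _.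
  have -> : y / x - 1 = (y - x) / x by rewrite mulrBl divff// gt_eqF.
  by rewrite ler_pdivrMr// ler_peMr ?subr_ge0// ltW.
move=> m0 l0 l'0; rewrite mulrC mulrBl.
have [ll'|/ltW ll'] := leP l l'; last rewrite distrC (distrC (l' / m)).
- by apply: main; rewrite ?divr_gt0// ler_pM2r// invr_gt0.
- by apply: main; rewrite ?divr_gt0// ler_pM2r// invr_gt0.
Qed.

Lemma le_excess m m' l : 0 < m -> m <= m' -> 0 < l -> excess m' l <= excess m l.
Proof.
move=> m0 mm' l0; have m'0 := lt_le_trans m0 mm'.
rewrite /excess ge_max le_max lexx/= le_max ler_ln ?posrE ?divr_gt0//.
by rewrite ler_pM2l// lef_pV2 ?posrE// mm' orbT.
Qed.

Lemma lt_excess m m' l : 0 < m -> m < m' -> 0 < l -> 0 < excess m l ->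
  excess m' l < excess m l.
Proof.
move=> m0 mm' l0; have m'0 := lt_trans m0 mm'.
rewrite {1}/excess lt_max ltxx/= => ex0.
have -> : excess m l = ln (l / m) by apply/max_idPr/ltW.
rewrite /excess gt_max ex0 ltr_ln ?posrE ?divr_gt0//.
by rewrite ltr_pM2l// ltf_pV2 ?posrE.
Qed.

End waterfilling.

(** * Capacity, water level and residual variance of a spectrum *)

Section attention.
Variable R : realType.
Implicit Types (lam : nat -> R) (m rho : R).

Lemma spectrum_gt0 lam i : spectrum lam -> 0 < lam i.
Proof.
by case=> _ _ _ anti inf; have [j ij /lt_le_trans] := inf i; apply; exact: anti.
Qed.

Lemma total_variance_gt0 lam : spectrum lam -> 0 < \sum_(0 <= i <oo) lam i.
Proof.
move=> sp; have lam0 i := spectrum_gt0 i sp.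
apply: lt_le_trans (lam0 0%N) (sum_oo_ge_term 0 _ _); first by case: sp.
by move=> j; exact: ltW.
Qed.

Lemma in_l1_excess m lam : 0 < m -> spectrum lam ->
  (l1norm (fun i => excess m (lam i)) < +oo)%E.
Proof.
move=> m0 sp; have [_ fin _ _ _] := sp.
by apply: in_l1_le (in_l1Z m^-1 fin) _ => i; exact/excess_le/spectrum_gt0.
Qed.

Lemma in_l1_passthrough m lam (v : nat -> R) : 0 < m -> spectrum lam ->
  (l1norm v < +oo)%E -> (l1norm (fun i => passthrough m (lam i) * v i)%R < +oo)%E.
Proof.
move=> m0 sp vfin; apply: in_l1_le vfin _ => i.
by rewrite normrM ler_piMl// passthrough_norm_le1// spectrum_gt0.
Qed.

Lemma mustar_excess rho lam m : is_mustar rho lam m ->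
  \sum_(0 <= i <oo) excess m (lam i) = 2 * rho.
Proof. by case=> _ <-; rewrite mulrA divff// mul1r. Qed.

Lemma le_sum_excess m m' lam : spectrum lam -> 0 < m -> m <= m' ->
  \sum_(0 <= i <oo) excess m' (lam i) <= \sum_(0 <= i <oo) excess m (lam i).
Proof.
move=> sp m0 mm'; apply: le_l1_sum; first exact/in_l1_excess/sp/(lt_le_trans m0).
- exact: in_l1_excess.
- by move=> i; exact/le_excess/spectrum_gt0.
Qed.

(** A positive sum has a mode of positive excess; there the comparison is strict, and it is weak at
    all other modes. *)
Lemma lt_sum_excess m m' lam : spectrum lam -> 0 < m -> m < m' ->
    0 < \sum_(0 <= i <oo) excess m (lam i) ->
  \sum_(0 <= i <oo) excess m' (lam i) < \sum_(0 <= i <oo) excess m (lam i).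
Proof.
move=> sp m0 mm'.
have [|/existsNP[i /negP]] := pselect (forall i, excess m (lam i) <= 0); last first.
  rewrite -ltNge => exi _.
  have fin := in_l1_excess m0 sp.
  have fin' := in_l1_excess (lt_trans m0 mm') sp.
  rewrite -subr_gt0 -l1_sumB//.
  apply: lt_le_trans (sum_oo_ge_term i _ _); last 2 first.
  - exact: in_l1B.
  - by move=> j; rewrite subr_ge0; exact/le_excess/spectrum_gt0/sp/ltW.
  by rewrite subr_gt0 lt_excess// spectrum_gt0.
move=> ex0; have -> : \sum_(0 <= i <oo) excess m (lam i) = 0; last by rewrite ltxx.
rewrite (@eq_sum_oo _ _ (fun=> 0)) => [|i].
  by rewrite (_ : (fun n => _) = fun=> 0) ?lim_cst//; apply/funext => n; rewrite big1.
by apply/le_anti; rewrite ex0 excess_ge0.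
Qed.

(** The capacity used at the fixed levels [mu0 + e] and [mu0 - e] is continuous in the spectrum and
    strictly on either side of [2 * rho] at [lam0], hence also nearby; monotonicity in the level
    then traps [mu t]. *)
Lemma mustar_cvg {T : Type} {F : set_system T} {FF : ProperFilter F}
    rho (lam : T -> nat -> R) (mu : T -> R) lam0 mu0 :
    0 < rho -> spectrum lam0 -> is_mustar rho lam0 mu0 ->
    (\forall t \near F, spectrum (lam t) /\ is_mustar rho (lam t) (mu t)) ->
    l1norm (fun i => lam t i - lam0 i) @[t --> F] --> 0%E ->
  mu t @[t --> F] --> mu0.
Proof.
move=> rho0 sp0 mu0P lamP lamcvg.
have mu00 : 0 < mu0 by case: mu0P.
have ex0 : \sum_(0 <= i <oo) excess mu0 (lam0 i) = 2 * rho by exact: mustar_excess.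
have excvg c : 0 < c -> \sum_(0 <= i <oo) excess c (lam t i) @[t --> F] -->
                        \sum_(0 <= i <oo) excess c (lam0 i).
  move=> c0; apply/cvgrPdist_le => /= e e0.
  apply: filterS2 lamP (near_l1norm_le lamcvg (mulr_gt0 c0 e0)) => t [sp _] le_ce.
  rewrite distrC -l1_sumB; [|exact: in_l1_excess..].
  apply: l1_sum_norm_le; apply: le_trans (l1norm_le _) _.
    by move=> i; apply: excess_lipschitz => //; exact: spectrum_gt0.
  rewrite /l1norm; under eq_eseriesr => i _ do rewrite normrM EFinM.
  rewrite nneseriesZl; last by move=> i _; rewrite lee_fin.
  rewrite gtr0_norm ?invr_gt0// -lee_pdivlMl ?invr_gt0// invrK.
  by rewrite -EFinM.
apply/cvgrPdist_le => /= e e0.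
have up : \forall t \near F, mu t < mu0 + e.
  have c0 : 0 < mu0 + e by rewrite addr_gt0.
  have lt2 : \sum_(0 <= i <oo) excess (mu0 + e) (lam0 i) < 2 * rho.
    by rewrite -ex0 lt_sum_excess// ?ltrDl// ex0 mulr_gt0.
  have /excvg/cvgr_lt/(_ _ lt2) := c0.
  apply: filterS2 lamP => t [sp mut] ltc.
  rewrite ltNge; apply/negP => /(le_sum_excess sp c0).
  by rewrite (mustar_excess mut) leNgt ltc.
(* If [mu0 - e] is not a positive level, [0 < mu t] already gives the lower bound. *)
have [mue|emu] := leP mu0 e.
  apply: filterS2 lamP up => t [_ [mut _]] mue'.
  by rewrite ler_norml; apply/andP; split; lra.
have c0 : 0 < mu0 - e by rewrite subr_gt0.
have lt2 : 2 * rho < \sum_(0 <= i <oo) excess (mu0 - e) (lam0 i).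
  rewrite -ex0 lt_sum_excess//; first lra.
  apply: (@lt_le_trans _ _ (2 * rho)); first by rewrite mulr_gt0.
  by rewrite -ex0 le_sum_excess//; lra.
have /excvg/cvgr_gt/(_ _ lt2) := c0.
apply: filterS3 lamP up => t [sp mut] ltu ltc.
have : mu0 - e < mu t.
  rewrite ltNge; apply/negP => muc; have [mut0 _] := mut.
  have := le_sum_excess sp mut0 muc.
  by rewrite (mustar_excess mut) leNgt ltc.
by rewrite ler_norml => ?; apply/andP; split; lra.
Qed.

(** Since the spectrum decreases, the attended modes are the first [n], with [n] least such that
    [lam n <= m]: each of them leaves [m], every later one its full variance. The termwise form
    avoids the dependence on [n]. *)
Lemma residual_varianceE m lam : 0 < m -> spectrum lam ->
  residual_variance m lam = \sum_(0 <= i <oo) Num.min (lam i) m.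
Proof.
move=> m0 sp; have [_ fin _ anti _] := sp.
have lam0 i : 0 < lam i := spectrum_gt0 i sp.
have minfin : (l1norm (fun i => Num.min (lam i) m) < +oo)%E.
  apply: in_l1_le fin _ => i.
  have min0 : 0 <= Num.min (lam i) m by rewrite le_min !ltW.
  by rewrite (ger0_norm min0) (gtr0_norm (lam0 i)) ge_min lexx.
have : exists n, lam n <= m.
  have /cvg_series_cvg_0/cvgr_lt/(_ _ m0)[N _ /(_ N (leqnn N))] := in_l1_cvg fin.
  by move=> /ltW; exists N.
move=> /ex_minnP[n lamn nmin].
have modesE : attention_modes m lam = n.
  rewrite /attention_modes; apply: card_fset_set.
  suff -> : [set i | m < lam i] = `I_n by rewrite card_eqxx.
  apply/seteqP; split => i /=.
    by move=> mi; rewrite ltnNge; apply/negP => /anti/le_trans/(_ lamn); rewrite leNgt mi.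
  by move=> ni; rewrite ltNge; apply/negP => /nmin; rewrite leqNgt ni.
rewrite /residual_variance modesE.
have split_sum (u : nat -> R) : (l1norm u < +oo)%E ->
    \sum_(0 <= i <oo) u i = \sum_(0 <= i < n) u i + \sum_(n <= i <oo) u i.
  move=> /in_l1_cvg cu.
  have ctail : cvgn (fun k => \sum_(n <= i < k) u i).
    by have := is_cvg_series_restrict n u => ->.
  apply: cvg_lim => //; apply: cvg_trans (cvgD (cvg_cst _) ctail) => /=.
  apply: near_eq_cvg; near=> k; rewrite [RHS](@big_cat_nat _ _ _ n)//=.
  by near: k; exact: nbhs_infty_ge.
rewrite (split_sum _ minfin); congr (_ + _).
  rewrite (eq_big_nat _ _ (F2 := fun=> m)) ?sumr_const_nat ?subn0 ?mulr_natl//.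
  move=> i /andP[_ ni]; apply/min_idPr/ltW.
  by rewrite ltNge; apply/negP => /nmin; rewrite leqNgt ni.
congr (limn _); apply/funext => k; apply: eq_big_nat => i /andP[ni _].
by apply/esym/min_idPl; exact: le_trans (anti _ _ ni) lamn.
Unshelve. all: by end_near. Qed.

Lemma residual_variance_passthrough m lam : 0 < m -> spectrum lam ->
  residual_variance m lam = \sum_(0 <= i <oo) passthrough m (lam i) * lam i.
Proof.
move=> m0 sp; rewrite residual_varianceE//; apply: eq_sum_oo => i.
by rewrite passthroughM// spectrum_gt0.
Qed.

Lemma residual_variance_le rho m lam m' lam' :
    spectrum lam -> is_mustar rho lam m -> spectrum lam' -> is_mustar rho lam' m' ->
  residual_variance m' lam' <= \sum_(0 <= i <oo) (passthrough m (lam i) * lam' i).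
Proof.
move=> sp mP sp' mP'; have [m0 _] := mP; have [m'0 _] := mP'.
have [_ fin' _ _ _] := sp'.
have wfin := in_l1_passthrough m0 sp fin'.
have wfin' := in_l1_passthrough m'0 sp' fin'.
have efin := in_l1Z m' (in_l1_excess m0 sp).
have efin' := in_l1Z m' (in_l1_excess m'0 sp').
(* The same number [m' * (2 * rho)] is added on both sides, then read as the total excess of [lam']
   on the left and of [lam] on the right, so that the tangent inequality applies mode by mode. *)
rewrite residual_variance_passthrough// -(lerD2r (m' * (2 * rho))).
rewrite -[in leLHS](mustar_excess mP') -(mustar_excess mP).
rewrite -!l1_sumZ -?l1_sumD//; [|exact: in_l1_excess..].
apply: le_l1_sum => [||i]; [exact: in_l1D..|].
have lam0 := spectrum_gt0 i sp; have lam'0 := spectrum_gt0 i sp'.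
by rewrite passthroughM// waterfilling_tangent.
Qed.

End attention.

(** * Filters to the right of 0 *)

Lemma near_right_itv {R : realType} (eps : R) : 0 < eps ->
  \forall t \near 0^'+, t \in `[0, eps].
Proof.
move=> eps0; near=> t; rewrite in_itv/=; apply/andP; split=> //.
by near: t; exact: nbhs_right_le.
Unshelve. all: by end_near. Qed.

(** Turns the derivative at the endpoint 0, taken within the time interval, into a right
    derivative. *)
Lemma at_right_within_itv {R : realType} (eps : R) : 0 < eps ->
  0^'+ --> within `[0, eps] 0^'.
Proof.
move=> eps0 P nP.
have {}nP : \forall t \near (0 : R), t != 0 -> t \in `[0, eps] -> P t := nP.
have {}nP : \forall t \near 0^'+, t != 0 -> t \in `[0, eps] -> P t.
  by apply: cvg_within; exact: nP.
have := near_right_itv eps0; apply: filterS3 (nbhs_right_neq 0) nP => t.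
by move=> t0 + tin; exact.
Qed.

(** * Right derivatives of total and residual variance at time 0 *)

Section variation.
Variables (R : realType) (rho eps : R) (lam dlam : R -> nat -> R) (mu : R -> R).
Hypotheses (rho_gt0 : 0 < rho) (eps_gt0 : 0 < eps).
Hypothesis lam_C1 : C1_into_l1 eps lam dlam.
Hypothesis lam_spectrum : forall t, t \in `[0, eps] -> spectrum (lam t).
Hypothesis mustarP : forall t, t \in `[0, eps] -> is_mustar rho (lam t) (mu t).

Let zero_in : (0 : R) \in `[0, eps].
Proof. by rewrite in_itv/= lexx ltW. Qed.

Let dlam0_fin : (l1norm (dlam 0) < +oo)%E.
Proof. by case: (lam_C1 zero_in). Qed.

Let lam_fin t : t \in `[0, eps] -> (l1norm (lam t) < +oo)%E.
Proof. by case/lam_spectrum. Qed.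

Let quotient t i := (lam t i - lam 0 i) / t.

Let quotient_cvg :
  l1norm (fun i => quotient t i - dlam 0 i) @[t --> 0^'+] --> 0%E.
Proof.
have [_ cv _] := lam_C1 zero_in.
apply: cvg_trans cv.
have -> : (fun t => l1norm (fun i => quotient t i - dlam 0 i)) =
          (fun t => l1norm (fun i => (lam t i - lam 0 i) / (t - 0) - dlam 0 i)).
  by apply/funext => t; rewrite subr0.
exact/cvg_app/at_right_within_itv.
Qed.

Let lam_cvg : l1norm (fun i => lam t i - lam 0 i) @[t --> 0^'+] --> 0%E.
Proof.
have [c cE] := in_l1_fin dlam0_fin.
have c0 : 0 <= c by rewrite -lee_fin -cE l1norm_ge0.
(* Once the difference quotient is within 1 of the derivative, whose norm is [c], the increment has
   norm at most [t * (1 + c)]. *)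
apply: (@squeeze_cvge _ _ _ _ (fun=> 0%E) _ (fun t => (t * (1 + c))%:E)); last 2 first.
- exact: cvg_cst.
- apply: cvg_EFin; first exact: nearW.
  rewrite -[X in _ --> X](mul0r (1 + c)); apply: cvgMr_tmp.
  by apply: cvg_at_right_filter; exact: cvg_id.
apply: filterS2 (nbhs_right_gt 0) (near_l1norm_le quotient_cvg ltr01) => t t0 qt.
rewrite l1norm_ge0/=.
have -> : (fun i => lam t i - lam 0 i) = (fun i => t * quotient t i).
  by apply/funext => i; rewrite /quotient mulrC divfK// gt_eqF.
rewrite /l1norm; under eq_eseriesr => i _ do rewrite normrM EFinM.
rewrite nneseriesZl; last by move=> i _; rewrite lee_fin.
rewrite gtr0_norm// EFinM lee_pmul2l// ?lte_fin// -/(l1norm _).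
have -> : quotient t = (fun i => (quotient t i - dlam 0 i) + dlam 0 i).
  by apply/funext => i; rewrite subrK.
rewrite EFinD -cE; apply: le_trans (leeD qt (lexx _)).
rewrite /l1norm -nneseriesD//; apply: lee_nneseries => i *; rewrite -?EFinD lee_fin//.
exact: ler_normD.
Qed.

Let mu_cvg : mu t @[t --> 0^'+] --> mu 0.
Proof.
apply: (mustar_cvg rho_gt0 (lam_spectrum zero_in) (mustarP zero_in) _ lam_cvg).
by apply: filterS (near_right_itv eps_gt0) => t tin; split; auto.
Qed.

Lemma total_variance_rderiv :
  (\sum_(0 <= i <oo) lam t i - \sum_(0 <= i <oo) lam 0 i) / t @[t --> 0^'+] -->
  \sum_(0 <= i <oo) dlam 0 i.
Proof.
apply: cvg_trans (l1_sum_cvg dlam0_fin quotient_cvg); apply: near_eq_cvg.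
apply: filterS (near_right_itv eps_gt0) => t tin.
have fint := lam_fin tin; have fin0 := lam_fin zero_in.
rewrite /quotient -l1_sumB// mulrC -l1_sumZ; last exact: in_l1B.
by apply: eq_sum_oo => i; rewrite mulrC.
Qed.

Lemma residual_variance_rderiv :
  (residual_variance (mu t) (lam t) - residual_variance (mu 0) (lam 0)) / t
    @[t --> 0^'+] -->
  \sum_(0 <= i <oo) (passthrough (mu 0) (lam 0 i) * dlam 0 i).
Proof.
pose w t i := passthrough (mu t) (lam t i).
have mu0 t : t \in `[0, eps] -> 0 < mu t by case/mustarP.
have lam0 i t : t \in `[0, eps] -> 0 < lam t i by move/lam_spectrum/spectrum_gt0.
have w1 t : t \in `[0, eps] -> forall i, `|w t i| <= 1.
  by move=> tin i; apply: passthrough_norm_le1; auto.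
have wcvg i : w t i @[t --> 0^'+] --> w 0 i.
  have minc : {for mu 0 / lam 0 i, continuous (fun x : R => Num.min 1 x)}.
    by apply: (@continuous_min R R (cst 1) id); [exact: cst_continuous|exact: cvg_id].
  apply: (@cvg_comp _ _ _ (fun t => mu t / lam t i) (Num.min 1)) minc.
  apply: cvgM; first exact: mu_cvg.
  apply: cvgV; first by rewrite gt_eqF// lam0.
  exact: (l1_cvg_entry lam_cvg (i := i)).
have w_int t s : t \in `[0, eps] -> s \in `[0, eps] ->
    \sum_(0 <= i <oo) (w s i * (lam t i - lam 0 i)) =
    \sum_(0 <= i <oo) (w s i * lam t i) - \sum_(0 <= i <oo) (w s i * lam 0 i).
  move=> tin sin; rewrite -l1_sumB.
  - by apply: eq_sum_oo => i; rewrite mulrBr.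
  - by apply: in_l1_passthrough; auto.
  - by apply: in_l1_passthrough; auto.
have wq t s : t \in `[0, eps] -> s \in `[0, eps] ->
    \sum_(0 <= i <oo) (w s i * quotient t i) =
    (\sum_(0 <= i <oo) (w s i * lam t i) - \sum_(0 <= i <oo) (w s i * lam 0 i)) / t.
  move=> tin sin; rewrite -w_int// [RHS]mulrC -l1_sumZ.
    by apply: eq_sum_oo => i; rewrite /quotient; ring.
  by apply: in_l1_passthrough; auto; apply: in_l1B; auto.
(* Weights taken at [t] bound the quotient from below, weights frozen at 0 from above. The limits
   agree because the weights converge entrywise and the quotients in l1. *)
apply: (@squeeze_cvgr _ _ _ _ (fun t => \sum_(0 <= i <oo) (w t i * quotient t i))
                              (fun t => \sum_(0 <= i <oo) (w 0 i * quotient t i))).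
- apply: filterS2 (nbhs_right_gt 0) (near_right_itv eps_gt0) => t t0 tin.
  have [spt sp0] := (lam_spectrum tin, lam_spectrum zero_in).
  have [mut mu0'] := (mustarP tin, mustarP zero_in).
  rewrite !wq// -!residual_variance_passthrough//; [|exact: mu0..].
  rewrite !ler_pM2r ?invr_gt0//; apply/andP; split.
    by rewrite lerD2l lerN2; exact: residual_variance_le sp0 mu0'.
  by rewrite lerD2r; exact: residual_variance_le spt mut.
- apply: l1_weighted_sum_cvg => //; last exact: w1.
  by exact: filterS w1 (near_right_itv eps_gt0).
- apply: l1_weighted_sum_cvg => //; [|exact: w1|by move=> i; exact: cvg_cst].
  by apply: nearW => t; exact: w1.
Qed.

End variation.

(** * Differential calculus of the team loss *)

Section comparative_statics.
Context {R : realType}.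

Lemma is_derive_loss (g : R -> R) (a b dg x : R) : 0 < x -> is_derive x 1 g dg ->
  is_derive x 1 (fun y => (4 * y)^-1 * a + g y / 2 * b)
                (dg / 2 * b - a / (4 * x ^+ 2)).
Proof.
move=> x0 dgx.
have dlin : is_derive x 1 (fun y : R => 4 * y) 4.
  by apply: (@is_derive_eq _ _ _ (4 \*: id)) => /=; rewrite /GRing.scale/= mulr1.
have dinv : is_derive x 1 (fun y : R => (4 * y)^-1) (- (4 * x) ^- 2 *: 4).
  by apply: is_deriveV; rewrite mulf_neq0// gt_eqF.
have -> : (fun y => (4 * y)^-1 * a + g y / 2 * b) =
          (a \*: (fun y => (4 * y)^-1)) + ((b / 2) \*: g).
  apply/funext => y.
  by change ((4 * y)^-1 * a + g y / 2 * b = a * (4 * y)^-1 + b / 2 * g y); ring.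
apply: is_derive_eq; rewrite /GRing.scale/=.
by field; rewrite gt_eqF.
Qed.
Lemma derivable_loss_slope (g : R -> R) (a b x : R) : 0 < x -> derivable g x 1 ->
  derivable (fun y => g y / 2 * b - a / (4 * y ^+ 2)) x 1.
Proof.
move=> x0 dg.
have -> : (fun y => g y / 2 * b - a / (4 * y ^+ 2)) =
          ((b / 2) \*: g) - ((a / 4) \*: (fun y => (y ^+ 2)^-1)).
  apply/funext => y.
  change (g y / 2 * b - a / (4 * y ^+ 2) = b / 2 * g y - a / 4 * (y ^+ 2)^-1).
  by rewrite invfM; ring.
apply: derivableB; first exact: derivableZ.
apply/derivableZ/derivableV; first by rewrite expf_neq0// gt_eqF.
exact: exprn_derivable.
Qed.

Lemma derivable_expansion (g : R -> R) (x e : R) : derivable g x 1 -> 0 < e ->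
  \forall y \near x, `|g y - g x - derive1 g x * (y - x)| <= e * `|y - x|.
Proof.
move=> dg e0; have : h^-1 *: (g (h *: 1 + x) - g x) @[h --> 0^'] --> derive1 g x.
  by rewrite derive1E; exact: dg.
move=> /cvgrPdist_le/(_ _ e0)/nbhs_ballP[r /= r0 rP].
apply/nbhs_ballP; exists r => //= y; rewrite /ball/= => xy.
have [->|yx] := eqVneq y x; first by rewrite !subrr mulr0 subrr normr0 mulr0.
have yx0 : y - x != 0 by rewrite subr_eq0.
have hr : ball 0 r (y - x) by rewrite /ball/= sub0r normrN distrC.
have := rP (y - x) hr yx0.
rewrite /GRing.scale/= mulr1 subrK -(ler_pM2r (x := `|y - x|)) ?normr_gt0//.
by rewrite -normrM mulrBl mulrAC mulVf// mul1r distrC.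
Qed.

Lemma rderiv_cvg (g : R -> R) (l : R) :
  (g t - g 0) / t @[t --> 0^'+] --> l -> g t @[t --> 0^'+] --> g 0.
Proof.
move=> gl; apply/subr_cvg0.
have tl : t * ((g t - g 0) / t) @[t --> 0^'+] --> 0 * l.
  by apply: cvgM gl; apply: cvg_at_right_filter; exact: cvg_id.
rewrite mul0r in tl; apply: cvg_trans tl; apply: near_eq_cvg.
apply: filterS (nbhs_right_gt 0) => t t0.
by rewrite mulrC divfK// gt_eqF.
Qed.

(** * Revealed preference and first-order condition for a family of losses *)

Variables (f A B k : R -> R) (dA dB : R).

Let loss a b y := (4 * y)^-1 * a + f y / 2 * b.

Hypotheses (f_cost : coordination_cost f) (B0 : 0 < B 0).
Hypotheses (opt0 : uniquely_optimal (loss (A 0) (B 0)) (k 0)) (k0 : 1 < k 0).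
Hypothesis near_opt : \forall t \near 0^'+,
  [/\ 0 < B t, uniquely_optimal (loss (A t) (B t)) (k t) & 1 < k t].
Hypothesis A_rderiv : (A t - A 0) / t @[t --> 0^'+] --> dA.
Hypothesis B_rderiv : (B t - B 0) / t @[t --> 0^'+] --> dB.

(** The minimizer depends on [A t] and [B t] only through their ratio; for [B t > 0], [q t] has the
    sign of the change of that ratio since time 0, and [s] is its right derivative. *)
Let q t := A t * B 0 - A 0 * B t.
Let s := dA * B 0 - A 0 * dB.

Let q_rderiv : q t / t @[t --> 0^'+] --> s.
Proof.
have -> : (fun t => q t / t) =
    (fun t => (A t - A 0) / t * B 0 - A 0 * ((B t - B 0) / t)).
  by apply/funext => t; rewrite /q; ring.
by apply: cvgB; [exact: cvgMr_tmp|exact: cvgMl_tmp].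
Qed.

Let q_cvg : q t @[t --> 0^'+] --> 0.
Proof.
have q0 : q 0 = 0 by rewrite /q mulrC subrr.
by rewrite -[X in _ --> X]q0; apply: (@rderiv_cvg q s); rewrite q0; under eq_cvg do rewrite subr0.
Qed.

(** Fermat's rule at an interior minimum, phrased with the smooth extension [F] because [f] is
    constrained only from 1 on. *)
Lemma loss_foc (F : R -> R) (a b x : R) :
    (forall x : R, derivable F x 1) -> {in `[1, +oo[, F =1 f} ->
    uniquely_optimal (loss a b) x -> 1 < x ->
  derive1 F x / 2 * b = a / (4 * x ^+ 2).
Proof.
move=> dF Ff [_ xmin] x1; have x0 : 0 < x by rewrite (lt_trans ltr01).
have d1 (y : R) : 0 < y -> is_derive y 1 (fun y => (4 * y)^-1 * a + F y / 2 * b)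
                (derive1 F y / 2 * b - a / (4 * y ^+ 2)).
  by move=> y0; apply: is_derive_loss => //; rewrite derive1E; exact/derivableP.
have : is_derive x 1 (fun y => (4 * y)^-1 * a + F y / 2 * b) 0.
  apply: (@derive1_at_min _ _ 1 (x + 1)).
  - by rewrite ltW// (lt_trans x1)// ltrDl.
  - move=> y; rewrite in_itv/= => /andP[y1 _].
    by have [] := d1 y (lt_trans ltr01 y1).
  - by rewrite in_itv/= x1 ltrDl ltr01.
  - move=> y; rewrite in_itv/= => /andP[y1 _].
    have [->|yx] := eqVneq y x; first exact: lexx.
    rewrite !Ff ?in_itv/= ?(ltW x1) ?(ltW y1)//.
    by apply/ltW/xmin => //; exact: ltW.
case=> _; have [_ ->] := d1 x x0.
by move/eqP; rewrite subr_eq0 => /eqP.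
Qed.

(** Optimality of [k t] at time [t] is weighted by [B 0] and the loss gap at time 0 by [B t]; in the
    sum the [f] terms cancel and only [q t] remains. *)
Let revealed_preference : \forall t \near 0^'+,
  B t * (loss (A 0) (B 0) (k t) - loss (A 0) (B 0) (k 0)) <=
  q t / 4 * ((k 0)^-1 - (k t)^-1).
Proof.
apply: filterS near_opt => t [Bt [_ opt_t] kt1].
have : 0 <= B 0 * (loss (A t) (B t) (k 0) - loss (A t) (B t) (k t)).
  rewrite mulr_ge0 ?subr_ge0//; first exact: ltW.
  have [->//|k0t] := eqVneq (k 0) (k t).
  by apply/ltW/opt_t => //; exact: ltW.
move=> h; rewrite -subr_ge0; apply: le_trans h _.
rewrite le_eqVlt; apply/orP; left; apply/eqP; rewrite /loss /q !invfM; ring.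
Qed.

Let loss0_min y : 1 <= y -> loss (A 0) (B 0) (k 0) <= loss (A 0) (B 0) y.
Proof.
move=> y1; have [->//|yk] := eqVneq y (k 0).
by case: opt0 => _ opt; exact/ltW/opt.
Qed.

(** The left side of [revealed_preference] is nonnegative, as [k 0] is optimal at time 0; so [q t]
    and [(k 0)^-1 - (k t)^-1] cannot have opposite signs. *)
Lemma nondecreasing_team_size : \forall t \near 0^'+, 0 < q t -> k 0 <= k t.
Proof.
apply: filterS2 near_opt revealed_preference => t [Bt _ kt1] rp qt.
rewrite leNgt; apply/negP => ktk0.
have : 0 <= B t * (loss (A 0) (B 0) (k t) - loss (A 0) (B 0) (k 0)).
  by rewrite mulr_ge0 ?subr_ge0// ?loss0_min// ltW.
move=> /le_trans/(_ rp); apply/negP; rewrite -ltNge.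
by rewrite pmulr_rlt0 ?divr_gt0// subr_lt0 ltf_pV2 ?posrE ?(lt_trans ltr01).
Qed.

Lemma nonincreasing_team_size : \forall t \near 0^'+, q t < 0 -> k t <= k 0.
Proof.
apply: filterS2 near_opt revealed_preference => t [Bt _ kt1] rp qt.
rewrite leNgt; apply/negP => ktk0.
have : 0 <= B t * (loss (A 0) (B 0) (k t) - loss (A 0) (B 0) (k 0)).
  by rewrite mulr_ge0 ?subr_ge0// ?loss0_min// ltW.
move=> /le_trans/(_ rp); apply/negP; rewrite -ltNge.
rewrite nmulr_rlt0; last by rewrite pmulr_llt0.
by rewrite subr_gt0 ltf_pV2 ?posrE ?(lt_trans ltr01).
Qed.

(** * Well-separated minimum and continuity of the team size *)

Let exists_extension : exists2 F : R -> R,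
  (forall (m : nat) (x : R), derivable (derive1n m F) x 1) & {in `[1, +oo[, F =1 f}.
Proof. by have [_ [F [dF Ff]] _ _] := f_cost; exists F. Qed.

Let continuous_loss0 (a b : R) : 1 <= a ->
  {within `[a, b], continuous (loss (A 0) (B 0))}.
Proof.
move=> a1; have [F dF Ff] := exists_extension.
pose lossF y := (4 * y)^-1 * A 0 + F y / 2 * B 0.
have lossFE : {in `[a, b]%classic, lossF =1 loss (A 0) (B 0)}.
  move=> y; rewrite inE/= in_itv/= => /andP[ay _].
  by rewrite /lossF /loss Ff// in_itv/= (le_trans a1).
apply: (subspace_eq_continuous lossFE).
apply: derivable_within_continuous => y; rewrite in_itv/= => /andP[ay _].
have y0 : 0 < y by rewrite (lt_le_trans ltr01)// (le_trans a1).
by have [] := is_derive_loss (A 0) (B 0) y0 (derivableP (dF 0%N y)).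
Qed.

Let segment_gap (a b : R) : 1 <= a -> ~~ (k 0 \in `[a, b]) ->
  exists2 e : R, 0 < e & {in `[a, b], forall y,
    loss (A 0) (B 0) (k 0) + e <= loss (A 0) (B 0) y}.
Proof.
move=> a1 k0ab; have [ab|ba] := leP a b; last first.
  exists 1 => // y; rewrite in_itv/= => /andP[ay yb].
  by have := le_lt_trans (le_trans ay yb) ba; rewrite ltxx.
have [c cab cmin] := EVT_min ab (@continuous_loss0 a b a1).
exists (loss (A 0) (B 0) c - loss (A 0) (B 0) (k 0)).
  rewrite subr_gt0; apply: (opt0.2).
    by move: cab; rewrite in_itv/= => /andP[ac _]; rewrite (le_trans a1).
  by apply: contraNneq k0ab => <-.
by move=> y yab; rewrite addrC subrK; exact: cmin.
Qed.

Let coercive_loss0 : exists M : R, forall y, M <= y -> 1 <= y ->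
  loss (A 0) (B 0) (k 0) + 1 <= loss (A 0) (B 0) y.
Proof.
have [_ _ _ /cvgryPge finfty] := f_cost.
(* Past this threshold [f y / 2 * B 0] exceeds the minimal loss by [1 +]|A 0|[, and the other term
   of the loss is at least]- [|A 0|]. *)
have [M [_ MP]] := finfty ((loss (A 0) (B 0) (k 0) + 1 + `|A 0|) * 2 / B 0).
exists (M + 1) => y My y1; have /MP : M < y by lra.
rewrite ler_pdivrMr// => fy; rewrite {2}/loss.
have y0 : 0 < y by rewrite (lt_le_trans ltr01).
have : `|(4 * y)^-1 * A 0| <= `|A 0|.
  rewrite normrM ler_piMl// gtr0_norm ?invr_gt0 ?mulr_gt0//.
  by rewrite invf_le1 ?mulr_gt0//; lra.
by rewrite ler_norml => /andP[+ _]; lra.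
Qed.

(** Away from [k 0] the domain consists of two compact segments, where uniqueness leaves a positive
    gap, and a ray where coercivity leaves a gap of 1. *)
Let gap d : 0 < d -> exists2 e : R, 0 < e &
  forall y, 1 <= y -> d <= `|y - k 0| ->
    loss (A 0) (B 0) (k 0) + e <= loss (A 0) (B 0) y.
Proof.
move=> d0; have [M MP] := coercive_loss0.
have notin1 : k 0 \notin `[1, k 0 - d].
  by rewrite in_itv/= negb_and -!ltNge; apply/orP; right; lra.
have notin2 : k 0 \notin `[k 0 + d, M].
  by rewrite in_itv/= negb_and -!ltNge; apply/orP; left; lra.
have le1 : 1 <= k 0 + d by have := k0; lra.
have [e1 e10 e1P] := segment_gap (lexx 1) notin1.
have [e2 e20 e2P] := segment_gap le1 notin2.
exists (Num.min 1 (Num.min e1 e2)); first by rewrite !lt_min ltr01 e10.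
move=> y y1 dy; have [My|/ltW yM] := leP M y.
  by apply: le_trans (MP _ My y1); rewrite lerD2l ge_min lexx.
move: dy; rewrite ler_normr => /orP[dy|dy].
  apply: le_trans (e2P y _); first by rewrite lerD2l !ge_min lexx !orbT.
  by rewrite in_itv/= yM andbT; lra.
apply: le_trans (e1P y _); first by rewrite lerD2l !ge_min lexx !orbT.
by rewrite in_itv/= y1/=; lra.
Qed.

Let near_B : \forall t \near 0^'+, B 0 / 2 < B t.
Proof. by apply: (cvgr_gt _ (rderiv_cvg B_rderiv)); have := B0; lra. Qed.

Lemma team_size_cvg : k t @[t --> 0^'+] --> k 0.
Proof.
apply/cvgrPdist_lt => /= d d0; have [e e0 eP] := gap d0.
have small_q : \forall t \near 0^'+, `|q t| < B 0 * e.
  have /cvgrPdist_lt/(_ _ (mulr_gt0 B0 e0)) := q_cvg.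
  by apply: filterS => t; rewrite sub0r normrN.
apply: filterS3 (filterI near_opt revealed_preference) near_B small_q.
move=> t [[Bt _ kt1] rp] Bt2 qt; rewrite distrC ltNge; apply/negP => dk.
have /(eP _ (ltW kt1)) := dk; rewrite -lerBrDl => ge_e.
have := le_trans (ler_wpM2l (ltW Bt) ge_e) rp.
have inv1 (x : R) : 1 < x -> 0 < x^-1 < 1.
  by move=> x1; rewrite invr_gt0 invf_lt1 ?x1 ?(lt_trans ltr01).
have /inv1/andP[k00 k01] := k0; have /inv1/andP[kt0 kt1'] := kt1.
have le1 : `|(k 0)^-1 - (k t)^-1| <= 1 by rewrite ler_norml; apply/andP; split; lra.
have := ler_norm (q t / 4 * ((k 0)^-1 - (k t)^-1)).
rewrite normrM => /le_trans/(_ (ler_piMr (normr_ge0 _) le1)).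
rewrite normrM (ger0_norm (_ : 0 <= 4^-1 :> R)) ?invr_ge0//.
have : B 0 / 2 * e < B t * e by rewrite ltr_pM2r.
have : 0 < B 0 * e by rewrite mulr_gt0.
by move: qt; lra.
Qed.

(** The derivative of the loss of time 0, with [f] replaced by its extension. *)
Let slope0 (F : R -> R) (y : R) := derive1 F y / 2 * B 0 - A 0 / (4 * y ^+ 2).

(** Substituting the first-order condition of time [t] gives [slope0 F (k t) = q t / (4 * k t ^+ 2 *
    B t)]. *)
Let slope_team_size_cvg (F : R -> R) :
    (forall (m : nat) (x : R), derivable (derive1n m F) x 1) ->
    {in `[1, +oo[, F =1 f} ->
  slope0 F (k t) / t @[t --> 0^'+] --> s / (4 * k 0 ^+ 2 * B 0).
Proof.
move=> dF Ff.
have den_cvg : 4 * k t ^+ 2 * B t @[t --> 0^'+] --> 4 * k 0 ^+ 2 * B 0.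
  apply: cvgM (rderiv_cvg B_rderiv); apply: cvgMl_tmp.
  by rewrite expr2; under eq_cvg do rewrite expr2; apply: cvgM; exact: team_size_cvg.
have den0 : 4 * k 0 ^+ 2 * B 0 != 0.
  by rewrite !mulf_neq0// ?expf_neq0// gt_eqF// (lt_trans ltr01).
apply: cvg_trans (cvgM q_rderiv (cvgV den0 den_cvg)); apply: near_eq_cvg.
apply: filterS2 near_opt (nbhs_right_gt 0) => t [Bt optt kt1] t0.
have kt0 : k t != 0 by rewrite gt_eqF// (lt_trans ltr01).
have Bt0 : B t != 0 by rewrite gt_eqF.
have := loss_foc (dF 0%N) Ff optt kt1.
move=> /(canRL (mulfK Bt0)) foc.
rewrite /slope0 foc/= /q; field.
by rewrite Bt0 kt0 gt_eqF.
Qed.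

Let near_slope (F : R -> R) (e : R) :
    (forall (m : nat) (x : R), derivable (derive1n m F) x 1) ->
    {in `[1, +oo[, F =1 f} -> 0 < e ->
  \forall t \near 0^'+,
    `|slope0 F (k t) - derive1 (slope0 F) (k 0) * (k t - k 0)| <= e * `|k t - k 0|.
Proof.
move=> dF Ff e0; have k00 : 0 < k 0 := lt_trans ltr01 k0.
have dslope : derivable (slope0 F) (k 0) 1.
  exact: derivable_loss_slope k00 (dF 1%N (k 0)).
have slope00 : slope0 F (k 0) = 0.
  by rewrite /slope0 (loss_foc (dF 0%N) Ff opt0 k0) subrr.
have near_k0 : \forall y \near k 0,
    `|slope0 F y - derive1 (slope0 F) (k 0) * (y - k 0)| <= e * `|y - k 0|.
  by apply: filterS (derivable_expansion dslope e0) => y; rewrite slope00 subr0.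
exact: team_size_cvg near_k0.
Qed.

(** As [k 0] lies in the open ray above 1, [f] and [F] agree around it and around all nearby points,
    so two derivatives may be taken. *)
Let derive1n2_loss (F : R -> R) :
    (forall (m : nat) (x : R), derivable (derive1n m F) x 1) ->
    {in `[1, +oo[, F =1 f} ->
  derive1n 2 (loss (A 0) (B 0)) (k 0) = derive1 (slope0 F) (k 0).
Proof.
move=> dF Ff; rewrite derive1nS !derive1E; apply: near_eq_derive.
have : \forall y \near k 0, 1 < y by exact: lt_nbhsr.
apply: filterS => y y1; have y0 := lt_trans ltr01 y1.
rewrite derive1n1 derive1E.
have eqF : \forall z \near y, (4 * z)^-1 * A 0 + F z / 2 * B 0 = loss (A 0) (B 0) z.
  have : \forall z \near y, 1 < z by exact: lt_nbhsr.
  by apply: filterS => z z1; rewrite /loss Ff// in_itv/= ltW.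
rewrite -(near_eq_derive _ eqF) /slope0.
have [_ ->] := is_derive_loss (A 0) (B 0) y0 (derivableP (dF 0%N y)).
by rewrite derive1E.
Qed.

(** * First-order behaviour of the team size according to the sign of [s] *)

Lemma weakly_increasing_team_size : 0 < s -> weakly_increasing_at0 k.
Proof.
move=> s0 e e0.
have q_gt0 : \forall t \near 0^'+, 0 < q t / t.
  exact: (cvgr_gt _ q_rderiv).
apply: filterS3 (nbhs_right_gt 0) nondecreasing_team_size q_gt0 => t t0 inc.
rewrite pmulr_lgt0 ?invr_gt0// => /inc kk.
apply: (@le_trans _ _ 0); first by rewrite oppr_le0 ltW.
by rewrite divr_ge0 ?subr_ge0//; exact: ltW.
Qed.

Lemma weakly_decreasing_team_size : s < 0 -> weakly_decreasing_at0 k.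
Proof.
move=> s0 e e0.
have q_lt0 : \forall t \near 0^'+, q t / t < 0.
  exact: (cvgr_lt _ q_rderiv).
apply: filterS3 (nbhs_right_gt 0) nonincreasing_team_size q_lt0 => t t0 dec.
rewrite pmulr_llt0 ?invr_gt0// => /dec kk.
apply: (@le_trans _ _ 0); last exact: ltW.
by rewrite pmulr_lle0 ?invr_gt0// subr_le0.
Qed.

(** The slope at [k t] is below [c / 2 * t] with [c < 0], yet it is at most [L] times the distance
    to [k 0] in absolute value; hence [k t] must fall at rate at least [- c / (2 * L)]. *)
Lemma not_weakly_increasing_team_size : s < 0 -> ~ weakly_increasing_at0 k.
Proof.
move=> s0 inc; have [F dF Ff] := exists_extension.
have k00 : 0 < k 0 := lt_trans ltr01 k0.
set c := s / (4 * k 0 ^+ 2 * B 0).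
have c0 : c < 0 by rewrite /c pmulr_llt0// invr_gt0 !mulr_gt0// exprn_gt0.
(* The summand 1 absorbs the linearization error and keeps [L] positive when the second derivative
   vanishes. *)
set L := `|derive1 (slope0 F) (k 0)| + 1.
have L0 : 0 < L by rewrite /L ltr_wpDl.
(* Half the forced rate of decrease, so that the Dini bound at this tolerance is violated. *)
have e0 : 0 < - c / (4 * L) by rewrite divr_gt0 ?mulr_gt0// oppr_gt0.
have c2 : c < c / 2 by lra.
have near_c : \forall t \near 0^'+, slope0 F (k t) / t < c / 2.
  exact: (cvgr_lt _ (slope_team_size_cvg dF Ff)).
have q_lt0 : \forall t \near 0^'+, q t / t < 0.
  exact: (cvgr_lt _ q_rderiv).
have [t [[t0 dec] [[ct lin] [qt inct]]]] := filter_ex (filterI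
  (filterI (nbhs_right_gt 0) nonincreasing_team_size)
  (filterI (filterI near_c (near_slope dF Ff ltr01))
           (filterI q_lt0 (inc _ e0)))).
have kk : k t <= k 0 by apply: dec; rewrite -(pmulr_llt0 _ (_ : 0 < t^-1)) ?invr_gt0.
have {}lin : - slope0 F (k t) <= L * (k 0 - k t).
  have xE : `|k t - k 0| = k 0 - k t by rewrite distrC ger0_norm ?subr_ge0.
  rewrite xE mul1r in lin.
  have := ler_normD (slope0 F (k t) - derive1 (slope0 F) (k 0) * (k t - k 0))
                    (derive1 (slope0 F) (k 0) * (k t - k 0)).
  rewrite subrK normrM xE.
  have := ler_norm (- slope0 F (k t)); rewrite normrN.
  by rewrite /L; lra.
move: ct; rewrite ltr_pdivrMr// => ct.
move: inct; rewrite mulNr opprK ler_pdivlMr// mulrAC ler_pdivrMr ?mulr_gt0// => inct.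
have : c * t < 0 by rewrite pmulr_llt0.
by move: inct; lra.
Qed.

(** With [s = 0] the slope at [k t] is [o(t)]. A linearization error of at most half the second
    derivative [d] keeps the slope above [d / 2] times the distance to [k 0], so that distance is
    [o(t)] too. *)
Lemma critical_team_size : s = 0 -> 0 < derive1n 2 (loss (A 0) (B 0)) (k 0) ->
  (k t - k 0) / t @[t --> 0^'+] --> 0.
Proof.
move=> s0; have [F dF Ff] := exists_extension.
rewrite (derive1n2_loss dF Ff); set d := derive1 _ _ => d0.
apply/cvgrPdist_le => e e0.
have d2 : 0 < d / 2 by rewrite divr_gt0.
have e1 : 0 < d / 2 * e by rewrite mulr_gt0.
have := slope_team_size_cvg dF Ff; rewrite s0 mul0r.
move=> /cvgrPdist_le/(_ _ e1) small.
apply: filterS3 (nbhs_right_gt 0) (near_slope dF Ff d2) small => t t0 lin.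
rewrite !sub0r !normrN !normrM (gtr0_norm (_ : 0 < t^-1)) ?invr_gt0//.
rewrite !ler_pdivrMr// => small.
rewrite -(ler_pM2l d2) mulrA; apply: le_trans small.
have := ler_normB (slope0 F (k t)) (slope0 F (k t) - d * (k t - k 0)).
rewrite subKr normrM (gtr0_norm d0) => /le_trans tri.
by have := tri _ (lerD (lexx _) lin); lra.
Qed.

End comparative_statics.

(** * Translation of the sign of [s] into the criterion *)

Theorem proposition2 (R : realType) (rho eps : R) (f : R -> R)
    (phi : nat -> R -> R) (lam dlam : R -> nat -> R) (mustar k : R -> R)
    (rho_gt0 : 0 < rho) (eps_gt0 : 0 < eps)
    (f_cost : coordination_cost f)
    (phi_basis : orthonormal_basis phi)
    (lam_C1 : C1_into_l1 eps lam dlam)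
    (lam_spectrum : forall t, t \in `[0, eps] -> spectrum (lam t))
    (kernel_cvg : forall t, t \in `[0, eps] -> kernel_converges phi (lam t))
    (kernel_feasible : forall t, t \in `[0, eps] ->
       feasible_kernel (spectral_kernel phi (lam t)))
    (mustarP : forall t, t \in `[0, eps] -> is_mustar rho (lam t) (mustar t))
    (k_optimal : forall t, t \in `[0, eps] ->
       uniquely_optimal (team_loss f (mustar t) (lam t)) (k t))
    (k_interior : forall t, t \in `[0, eps] -> 1 < k t)
    (k_nondegenerate :
       team_size_criterion (mustar 0) (lam 0) (dlam 0) = 0 ->
       0 < derive1n 2 (team_loss f (mustar 0) (lam 0)) (k 0)) :
  let criterion := team_size_criterion (mustar 0) (lam 0) (dlam 0) in
  (weakly_increasing_at0 k <-> 0 <= criterion) /\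
  (criterion <= 0 -> weakly_decreasing_at0 k).
Proof.
have zero_in : (0 : R) \in `[0, eps] by rewrite in_itv/= lexx ltW.
have [dlam_fin _ _] := lam_C1 _ zero_in.
have sp0 := lam_spectrum _ zero_in; have [mu0 _] := mustarP _ zero_in.
pose A t := residual_variance (mustar t) (lam t).
pose B t := \sum_(0 <= i <oo) lam t i.
have B0 : 0 < B 0 := total_variance_gt0 sp0.
have dA := residual_variance_rderiv rho_gt0 eps_gt0 lam_C1 lam_spectrum mustarP.
have dB := total_variance_rderiv eps_gt0 lam_C1 lam_spectrum.
set a := \sum_(0 <= i <oo) (passthrough _ _ * _) in dA.
set b := \sum_(0 <= i <oo) dlam 0 i in dB.
have near_opt : \forall t \near 0^'+, [/\ 0 < B t,
    uniquely_optimal (team_loss f (mustar t) (lam t)) (k t) & 1 < k t].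
  apply: filterS (near_right_itv eps_gt0) => t tin.
  by split; [exact/total_variance_gt0/lam_spectrum|exact: k_optimal|exact: k_interior].
have opt0 := k_optimal _ zero_in; have k0 := k_interior _ zero_in.
move=> criterion.
(* The left side is the right derivative of [q]; since [B 0 > 0], it has the sign of the
   criterion. *)
have criterionE : a * B 0 - A 0 * b = B 0 * criterion.
  have -> : criterion = a - A 0 / B 0 * b.
    rewrite /a /b -l1_sumZ// -l1_sumB; last 2 first.
    - exact: in_l1_passthrough.
    - exact: in_l1Z.
    by apply: eq_sum_oo => i; rewrite mulrBr mulrC [X in _ - X]mulrC.
  by field; rewrite gt_eqF.
have pos : 0 < criterion -> weakly_increasing_at0 k.
  move=> c0; apply: (weakly_increasing_team_size B0 opt0 k0 near_opt dA dB).
  by rewrite criterionE mulr_gt0.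
have neg : criterion < 0 -> weakly_decreasing_at0 k /\ ~ weakly_increasing_at0 k.
  move=> c0; have s0 : a * B 0 - A 0 * b < 0 by rewrite criterionE pmulr_rlt0.
  split; first exact: (weakly_decreasing_team_size B0 opt0 k0 near_opt dA dB s0).
  exact: (not_weakly_increasing_team_size f_cost B0 opt0 k0 near_opt dA dB s0).
have crit : criterion = 0 -> (k t - k 0) / t @[t --> 0^'+] --> 0.
  move=> c0; have s0 : a * B 0 - A 0 * b = 0 by rewrite criterionE c0 mulr0.
  have := k_nondegenerate c0.
  exact: (critical_team_size f_cost B0 opt0 k0 near_opt dA dB s0).
(* Necessity is by contraposition. At a zero criterion the right derivative of [k] is 0, which
   satisfies both Dini conditions. *)
split; first split=> [inc|].
- by rewrite leNgt; apply/negP => /neg[].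
- rewrite le_eqVlt => /predU1P[/esym c0|/pos//] e e0.
  have /cvgrPdist_le/(_ _ e0) := crit c0; apply: filterS => t.
  by rewrite sub0r normrN ler_norml => /andP[].
- rewrite le_eqVlt => /predU1P[c0|/neg[]//] e e0.
  have /cvgrPdist_le/(_ _ e0) := crit c0; apply: filterS => t.
  by rewrite sub0r normrN ler_norml => /andP[].
Qed.
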